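(* Let $G$ be a finite simple graph and let $m\geq 1$ be an integer. If $G$ is triangle-free with at least three edges and $d_{\min}(G)\geq 3$, then $d_{\min}(\mathsf{M}_m(G))\geq d_{\min}(G)+3$.
   Context: Graphs are finite, without loops or multiple edges. An orientation is acyclic if it contains no directed cycle. An arc of an acyclic orientation $D$ is dependent if reversing it creates a directed cycle. $d(D)$ is the number of dependent arcs of $D$, and $d_{\min}(G)$ is the minimum of $d(D)$ over all acyclic orientations $D$ of $G$. Generalized Mycielski graph: let $G$ have vertex set $V_0=\{\langle 0,0\rangle,\langle 0,1\rangle,\ldots,\langle 0,n-1\rangle\}$ and edge set $E_0$. For an integer $m>0$, $\mathsf{M}_m(G)$ has vertex set $V_0\cup\bigcup_{i=1}^m V_i\cup\{u\}$, where $V_i=\{\langle i,j\rangle : 0\leq j\leq n-1\}$, and edge set $E_0\cup\bigcup_{i=1}^m E_i\cup\{\langle m,j\rangle u : 0\leq j\leq n-1\}$, where $E_i=\{\langle i-1,j\rangle\langle i,k\rangle : \langle 0,j\rangle\langle 0,k\rangle\in E_0\}$ for $1\leq i\leq m$ (for each edge of $E_0$ both orders of $j,k$ are used). *)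

(* Defs.v *)
From mathcomp Require Import all_boot.

Set Implicit Arguments.
Unset Strict Implicit.
Unset Printing Implicit Defensive.

Record sgraph := SGraph {
  vertex :> finType;
  adj : rel vertex;
  adj_sym : symmetric adj;
  adj_irr : irreflexive adj
}.

Definition edges (G : sgraph) : {set {set G}} :=
  [set [set p.1; p.2] | p in [set p : G * G | adj p.1 p.2]].

Definition triangle_free (G : sgraph) : Prop :=
  forall x y z : G, ~~ [&& adj x y, adj y z & adj z x].

Definition darc (T : finType) (D : {set T * T}) : rel T :=
  fun x y => (x, y) \in D.

(* A directed cycle is a nonempty sequence of distinct vertices; its length is
   therefore at most #|T|, which makes the property decidable (see
   has_dicycleP). *)
Definition has_dicycle (T : finType) (D : {set T * T}) : bool :=
  [exists n : 'I_#|T|, [exists c : n.+1.-tuple T, ucycleb (darc D) c]].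

Lemma has_dicycleP (T : finType) (D : {set T * T}) :
  reflect (exists2 c : seq T, c != [::] & ucycle (darc D) c) (has_dicycle D).
Proof.
apply: (iffP existsP) => [[n /existsP[c cP]]|[c c0 cP]].
  by exists c => //; rewrite -size_eq0 size_tuple.
have /andP[_ Uc] := cP.
case: c c0 cP Uc => // x c _ cP Uc.
have lt_c : size c < #|T| by rewrite -[_.+1]/(size (x :: c)) -(card_uniqP Uc) max_card.
by exists (Ordinal lt_c); apply/existsP; exists (in_tuple (x :: c)).
Qed.

Definition orientation (G : sgraph) (D : {set G * G}) : bool :=
  [forall x : G, forall y : G,
    if adj x y then darc D x y (+) darc D y x else ~~ darc D x y].

Definition acyclic_orientation (G : sgraph) (D : {set G * G}) : bool :=
  orientation D && ~~ has_dicycle D.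

Definition reverse_arc (T : finType) (D : {set T * T}) (a : T * T) :
  {set T * T} := (a.2, a.1) |: (D :\ a).

Definition dependent_arcs (T : finType) (D : {set T * T}) : {set T * T} :=
  [set a in D | has_dicycle (reverse_arc D a)].

Definition ndep (T : finType) (D : {set T * T}) : nat := #|dependent_arcs D|.

Lemma ex_acyclic_orientation (G : sgraph) :
  exists D : {set G * G}, acyclic_orientation D.
Proof.
pose D := [set p : G * G | adj p.1 p.2 && (enum_rank p.1 < enum_rank p.2)].
have DE x y : darc D x y = adj x y && (enum_rank x < enum_rank y).
  by rewrite /darc inE.
exists D; apply/andP; split.
  apply/forallP=> x; apply/forallP=> y; rewrite !DE (adj_sym y x).
  case: ifP => [xy|->] //=.
  have : enum_rank x != enum_rank y :> nat.
    apply: contraTneq xy => /ord_inj/enum_rank_inj ->.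
    by rewrite adj_irr.
  by rewrite xy; case: ltngtP.
apply/negP => /has_dicycleP[[//|x c] _ /andP[/= cP _]].
pose f (z : G) : nat := enum_rank z.
have : path ltn (f x) (map f (rcons c x)).
  rewrite path_map; apply: sub_path cP => y z.
  by rewrite DE => /andP[].
move/(order_path_min ltn_trans)/allP/(_ (f x)).
by rewrite map_f ?mem_rcons ?mem_head //= ltnn => /(_ isT).
Qed.

Lemma ex_ndep (G : sgraph) :
  exists k, [exists D : {set G * G}, acyclic_orientation D && (ndep D == k)].
Proof.
have [D DP] := ex_acyclic_orientation G.
by exists (ndep D); apply/existsP; exists D; rewrite DP eqxx.
Qed.

Definition dmin (G : sgraph) : nat := ex_minn (ex_ndep G).

(* Some (i, x) is the copy of the vertex x of G in the layer V_i, and None is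
   the apex u. *)
Definition mycielski_adj (m : nat) (G : sgraph) :
    rel (option ('I_m.+1 * G)) :=
  fun a b => match a, b with
  | Some (i, x), Some (j, y) =>
      adj x y && [|| (i == 0 :> nat) && (j == 0 :> nat),
                     j == i.+1 :> nat | i == j.+1 :> nat]
  | Some (i, _), None | None, Some (i, _) => i == m :> nat
  | None, None => false
  end.

Lemma mycielski_adj_sym m G : symmetric (@mycielski_adj m G).
Proof.
move=> [[i x]|] [[j y]|] //=; rewrite (adj_sym x y).
by rewrite (andbC (i == 0 :> nat)) (orbC (j == i.+1 :> nat)).
Qed.

Lemma mycielski_adj_irr m G : irreflexive (@mycielski_adj m G).
Proof. by move=> [[i x]|] //=; rewrite adj_irr. Qed.

Definition mycielski (m : nat) (G : sgraph) : sgraph :=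
  SGraph (@mycielski_adj_sym m G) (@mycielski_adj_irr m G).

(* Main.v *)
Require Import Defs.
From mathcomp Require Import all_boot.

Set Implicit Arguments.
Unset Strict Implicit.
Unset Printing Implicit Defensive.

(** Replacing the vertices of an independent set [J] of [V_0] by their copies in
    [V_1] yields another induced copy of [G], which carries at least [dmin G]
    dependent arcs and avoids every arc of [V_0] that meets [J].  Since [V_0]
    itself carries three dependent arcs and, in a triangle-free graph, any three
    edges are met by one independent set, the choice of such a [J] exhibits
    [dmin G + 3] dependent arcs. *)

Section Dicycle.
Variables (S T : finType) (f : S -> T).
Hypothesis f_inj : injective f.

Lemma has_dicycle_inj (A : {set S * S}) (B : {set T * T}) :
  (forall x y, darc A x y -> darc B (f x) (f y)) ->
  has_dicycle A -> has_dicycle B.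
Proof.
move=> AB /has_dicycleP[c c0 /andP[cA c_uniq]].
apply/has_dicycleP; exists (map f c); first by case: c c0 {cA c_uniq}.
rewrite /ucycle map_inj_uniq // c_uniq andbT.
case: c c0 cA {c_uniq} => //= x c _.
by rewrite -map_rcons path_map; apply: sub_path => y z; apply: AB.
Qed.

Definition map_arc (a : S * S) : T * T := (f a.1, f a.2).

Lemma map_arc_inj : injective map_arc.
Proof. by move=> [x y] [x' y'] [/f_inj -> /f_inj ->]. Qed.

(** A cycle created by reversing [a] is carried by [f] to one created by reversing [map_arc a]: by
    injectivity no other arc is sent to the one removed. Only an inclusion holds, since a cycle in
    [T] may leave the image of [f]. *)
Lemma dependent_arcs_preim (D : {set T * T}) :
  dependent_arcs (map_arc @^-1: D) \subset map_arc @^-1: dependent_arcs D.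
Proof.
apply/subsetP=> a; rewrite !inE => /andP[-> /=].
apply: has_dicycle_inj => x y; rewrite /darc !inE.
case/orP=> [/eqP[-> ->]|/andP[xy_a ->]]; first by rewrite eqxx.
by rewrite -[(f x, f y)]/(map_arc (x, y)) (inj_eq map_arc_inj) xy_a orbT.
Qed.

End Dicycle.

Lemma dmin_le_ndep (G : sgraph) (D : {set G * G}) :
  acyclic_orientation D -> dmin G <= ndep D.
Proof.
move=> DP; rewrite /dmin; case: ex_minnP => k _; apply.
by apply/existsP; exists D; rewrite DP eqxx.
Qed.

Lemma dmin_attained (G : sgraph) :
  exists2 D : {set G * G}, acyclic_orientation D & dmin G = ndep D.
Proof.
rewrite /dmin; case: ex_minnP => k /existsP[D /andP[DP /eqP <-]] _.
by exists D.
Qed.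

(** Along an embedding as an induced subgraph, [D] pulls back to an acyclic orientation of [G] whose
    dependent arcs all map to dependent arcs of [D]. *)
Lemma dmin_embedding {G H : sgraph} {f : G -> H} {D : {set H * H}} :
  injective f -> (forall x y, adj (f x) (f y) = adj x y) ->
  acyclic_orientation D -> dmin G <= #|map_arc f @^-1: dependent_arcs D|.
Proof.
move=> f_inj f_adj /andP[/forallP Dor Dacyc].
apply: leq_trans (subset_leq_card (dependent_arcs_preim f_inj D)).
apply: dmin_le_ndep; apply/andP; split.
  apply/forallP=> x; apply/forallP=> y.
  by move/forallP/(_ (f y)): (Dor (f x)); rewrite f_adj /darc !inE.
by apply: contra Dacyc; apply: (has_dicycle_inj f_inj) => x y; rewrite /darc inE.
Qed.

Lemma independent_transversal3 {G : sgraph} {a1 b1 a2 b2 a3 b3 : G} :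
  triangle_free G -> adj a1 b1 -> adj a2 b2 -> adj a3 b3 ->
  exists x1 x2 x3 : G,
    [/\ (x1 == a1) || (x1 == b1), (x2 == a2) || (x2 == b2),
        (x3 == a3) || (x3 == b3)
      & [/\ ~~ adj x1 x2, ~~ adj x2 x3 & ~~ adj x1 x3]].
Proof.
move=> G_tf e1 e2 e3; set P := exists _, _.
have win x1 x2 x3 : (x1 == a1) || (x1 == b1) -> (x2 == a2) || (x2 == b2) ->
    (x3 == a3) || (x3 == b3) -> ~~ adj x1 x2 -> ~~ adj x2 x3 -> ~~ adj x1 x3 ->
    P.
  by exists x1, x2, x3.
have no_triangle (x y z : G) : adj x y -> adj y z -> adj x z -> False.
  by move=> xy yz xz; have := G_tf x y z; rewrite xy yz adj_sym xz.
(* A vertex adjacent to both ends of an edge would form a triangle with it. *)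
have avoid (x a b : G) : adj a b -> exists y, ((y == a) || (y == b)) && ~~ adj x y.
  move=> ab; have [xa|xa] := boolP (adj x a); last by exists a; rewrite eqxx.
  by exists b; rewrite eqxx orbT; apply/negP; apply: no_triangle xa ab.
(* If [y2] and [y3], both non-adjacent to [a1], are adjacent, then [b1] misses
   one of them; that one is compatible with both ends of the first edge, and any
   non-neighbour of it in the remaining edge is missed by [a1] or [b1]. *)
have [y2 /andP[y2P a1y2]] := avoid a1 _ _ e2.
have [y3 /andP[y3P a1y3]] := avoid a1 _ _ e3.
have [y2y3|y2y3] := boolP (adj y2 y3); last by apply: (win a1 y2 y3); rewrite ?eqxx.
have [b1y2|b1y2] := boolP (adj b1 y2).
  have b1y3 : ~~ adj b1 y3 by apply/negP => /(no_triangle _ _ _ b1y2 y2y3).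
  have [z2 /andP[z2P y3z2]] := avoid y3 _ _ e2.
  have [b1z2|b1z2] := boolP (adj b1 z2).
    apply: (win a1 z2 y3); rewrite ?eqxx // 1?adj_sym //.
    by apply/negP=> z2a1; apply: (no_triangle a1 b1 z2); rewrite // adj_sym.
  by apply: (win b1 z2 y3); rewrite ?eqxx ?orbT // adj_sym.
have [z3 /andP[z3P y2z3]] := avoid y2 _ _ e3.
have [b1z3|b1z3] := boolP (adj b1 z3).
  apply: (win a1 y2 z3); rewrite ?eqxx //.
  by apply/negP=> a1z3; apply: (no_triangle a1 b1 z3).
by apply: (win b1 y2 z3); rewrite ?eqxx ?orbT.
Qed.

(** The boolean [x \in J] is read as the layer, 0 or 1; layer 1 exists only when [0 < m]. *)
Definition lift_set (m : nat) (G : sgraph) (J : {set G}) (x : G) :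
    mycielski m G :=
  Some (inord (x \in J), x).

Lemma lift_set_inj (m : nat) (G : sgraph) (J : {set G}) :
  injective (lift_set m J).
Proof. by move=> x y []. Qed.

(** Only edges with both ends moved to [V_1] would be lost, and an independent [J] has none. *)
Lemma adj_lift_set {m : nat} {G : sgraph} {J : {set G}} :
  0 < m -> {in J &, forall x y, ~~ adj x y} ->
  forall x y, adj (lift_set m J x) (lift_set m J y) = adj x y.
Proof.
move=> m_gt0 J_ind x y /=; rewrite !inordK ?ltnS ?(leq_trans (leq_b1 _)) //.
have := J_ind x y; case: (x \in J); case: (y \in J) => //=; rewrite ?andbT //.
by move=> /(_ isT isT)/negPf->.
Qed.

Lemma acyclic_orientation_adj {G : sgraph} {D : {set G * G}} {a : G * G} :
  acyclic_orientation D -> a \in D -> adj a.1 a.2.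
Proof.
case: a => x y /andP[/forallP/(_ x)/forallP/(_ y)] /=.
by rewrite /darc; case: (adj x y) => // /negPf->.
Qed.

Theorem theorem15 (G : sgraph) (m : nat) (hm : 1 <= m)
  (G_triangle_free : triangle_free G) (G_edges : 3 <= #|edges G|)
  (G_dmin : 3 <= dmin G) :
  dmin G + 3 <= dmin (mycielski m G).
Proof.
have [D DP ->] := dmin_attained (mycielski m G).
pose f J := map_arc (lift_set m (G := G) J).
have f_inj J : injective (f J) by apply/map_arc_inj/lift_set_inj.
have ind0 : {in (set0 : {set G}) &, forall x y, ~~ adj x y}.
  by move=> x y; rewrite inE.
have copy (J : {set G}) : {in J &, forall x y, ~~ adj x y} ->
    dmin G <= #|f J @^-1: dependent_arcs D|.
  by move=> J_ind; apply: dmin_embedding (@lift_set_inj _ _ J) (adj_lift_set hm J_ind) DP.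
(* For [J] empty the copy is [V_0] itself. *)
have /card_gt2P[a1 [a2 [a3 [[a1P a2P a3P] [a12 a23 a31]]]]] :=
  leq_trans G_dmin (copy _ ind0).
have edge a : a \in f set0 @^-1: dependent_arcs D -> adj a.1 a.2.
  rewrite !inE => /andP[/(acyclic_orientation_adj DP) + _].
  by rewrite (adj_lift_set hm ind0).
have [x1 [x2 [x3 [x1P x2P x3P [n12 n23 n13]]]]] :=
  independent_transversal3 G_triangle_free (edge _ a1P) (edge _ a2P) (edge _ a3P).
pose J := [set x1; x2; x3].
have J_ind : {in J &, forall x y, ~~ adj x y}.
  move=> x y; rewrite !inE => /orP[/orP[]|] /eqP-> /orP[/orP[]|] /eqP->;
    by rewrite ?adj_irr // adj_sym.
pose A := [set a1; a2; a3].
have A3 : #|A| = 3.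
  by rewrite /A -setUA cardsU1 cards2 !inE negb_or a12 eq_sym a31 a23.
have AJ a : a \in A -> (a.1 \in J) || (a.2 \in J).
  rewrite !inE => /orP[/orP[]|] /eqP->;
    [case/orP: x1P|case/orP: x2P|case/orP: x3P] => /eqP<-; by rewrite eqxx ?orbT.
(* A common arc would have both ends in layer 0, hence outside [J], whereas every arc of [A] has an
   end in [J]. *)
have disj : [disjoint f J @: (f J @^-1: dependent_arcs D) & f set0 @: A].
  apply/pred0P=> b; apply/negbTE/negP => /andP[/imsetP[a _ ->]].
  case/imsetP=> a' /AJ a'J [] /(congr1 val) /= h1 e1 /(congr1 val) /= h2 e2.
  move: h1 h2 a'J; rewrite e1 e2 !in_set0 !inordK ?ltnS ?(leq_trans (leq_b1 _)) //.
  by do 2![case: (_ \in J)].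
have sub : f J @: (f J @^-1: dependent_arcs D) :|: f set0 @: A
             \subset dependent_arcs D.
  rewrite subUset; apply/andP; split; apply/subsetP=> b /imsetP[a aP ->].
    by rewrite inE in aP.
  have : a \in f set0 @^-1: dependent_arcs D.
    by move: aP; rewrite 2!in_setU !in_set1 => /orP[/orP[]|] /eqP->.
  by rewrite inE.
apply: leq_trans (subset_leq_card sub).
by rewrite cardsU disjoint_setI0 // cards0 subn0 !card_imset // A3 leq_add2r copy.
Qed.
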